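(* For every integer $n \geq 3$ and every proper subset $\mathcal{I}$ of $\{0,1,\ldots,n-1\}$ there exists an $n$-maniplex of type $2_{\mathcal{I}}^n$.
   Context: An $n$-maniplex $\mathcal{M}$ is a pair $(\mathcal{F},\{r_0,\ldots,r_{n-1}\})$ where $\mathcal{F}$ is a non-empty set (whose elements are called flags) and $r_0,\ldots,r_{n-1}$ are fixed-point-free involutory permutations of $\mathcal{F}$ such that: the group $\langle r_0,\ldots,r_{n-1}\rangle$ (the monodromy group) is transitive on $\mathcal{F}$; for every flag $\Phi$ and $i\neq j$, $\Phi^{r_i}\neq\Phi^{r_j}$; and $r_ir_j=r_jr_i$ whenever $|i-j|\geq 2$. Equivalently, it is a connected $n$-regular graph with a proper edge-colouring by colours $0,\ldots,n-1$ in which, for $|i-j|\ge 2$, the edges of colours $i$ and $j$ induce disjoint $4$-cycles. Flags $\Phi$ and $\Phi^{r_i}$ are called $i$-adjacent. An automorphism of $\mathcal{M}$ is a permutation of $\mathcal{F}$ commuting with every $r_i$; they form the group $\mathrm{Aut}(\mathcal{M})$. The symmetry type graph of $\mathcal{M}$ is the edge-coloured pregraph whose vertices are the $\mathrm{Aut}(\mathcal{M})$-orbits on flags, where for each colour $i$ and orbit $O$ (letting $O^{r_i}$ be the orbit containing $\Phi^{r_i}$ for any $\Phi\in O$, which is well defined) $O$ carries an $i$-coloured semi-edge if $O^{r_i}=O$, and otherwise $O$ and $O^{r_i}$ are joined by an $i$-coloured edge. For $\mathcal{I}\subseteq\{0,\ldots,n-1\}$, $2_{\mathcal{I}}^n$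 denotes the coloured pregraph with two vertices $u,v$, having for each $i\in\mathcal{I}$ an $i$-coloured semi-edge at $u$ and one at $v$, and for each $i\notin\mathcal{I}$ an $i$-coloured edge joining $u$ and $v$. A maniplex is of type $2_{\mathcal{I}}^n$ if its symmetry type graph is isomorphic (as a coloured pregraph) to $2_{\mathcal{I}}^n$; in particular it then has exactly two flag-orbits under its automorphism group. *)

(* Defs.v *)
From mathcomp Require Import all_boot ssrint.
From mathcomp Require Import boolp classical_sets.

Set Implicit Arguments.
Unset Strict Implicit.
Unset Printing Implicit Defensive.

Local Open Scope classical_set_scope.

(* The group of permutations of T generated by a family r of permutations. *)
Inductive generated (T K : Type) (r : K -> T -> T) : (T -> T) -> Prop :=
| generated_id : generated r id
| generated_base k : generated r (r k)
| generated_comp f g : generated r f -> generated r g -> generated r (f \o g)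
| generated_inv f g : cancel f g -> cancel g f ->
    generated r f -> generated r g.

(* The flag set may be infinite. *)
Record maniplex (n : nat) := Maniplex {
  flag : Type;
  adj : 'I_n -> flag -> flag;
  flag_nonempty : inhabited flag;
  adjK : forall i, involutive (adj i);
  adj_fixfree : forall i x, adj i x <> x;
  adj_trans : forall x y, exists2 w, generated adj w & w x = y;
  adj_neq : forall i j x, i != j -> adj i x <> adj j x;
  adj_comm : forall (i j : 'I_n) x, (2 <= `|i - j|)%N ->
    adj i (adj j x) = adj j (adj i x)
}.

Definition automorphism n (M : maniplex n) (g : flag M -> flag M) : Prop :=
  bijective g /\ forall i x, g (adj i x) = adj i (g x).

Definition flag_orbit n (M : maniplex n) (x : flag M) : set (flag M) :=
  [set y | exists2 g, automorphism g & g x = y].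

Definition flag_orbits n (M : maniplex n) : set (set (flag M)) :=
  [set O | exists x, O = flag_orbit x].

(* A pregraph is given by its darts (half-edges) and the involution that
   reverses them: an edge is a pair {d, drev d}, and it is a semi-edge exactly
   when drev d = d. *)
Record cpregraph (C : Type) := CPregraph {
  vertex : Type;
  dart : Type;
  origin : dart -> vertex;
  drev : dart -> dart;
  colour : dart -> C;
  drevK : involutive drev;
  colour_drev : forall d, colour (drev d) = colour d
}.

Definition cpregraph_iso (C : Type) (G H : cpregraph C) : Prop :=
  exists (fV : vertex G -> vertex H) (fD : dart G -> dart H),
    [/\ bijective fV, bijective fD,
        forall d, origin (fD d) = fV (origin d),
        forall d, drev (fD d) = fD (drev d) &
        forall d, colour (fD d) = colour d].

Section SymmetryTypeGraph.
Variables (n : nat) (M : maniplex n).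

Lemma image_adj_orbit i (x : flag M) : adj i @` flag_orbit x = flag_orbit (adj i x).
Proof.
apply/seteqP; split=> [y [_ [g [gb gc] <-] <-]|y [g [gb gc] <-]].
  by exists g; [split|rewrite gc].
by exists (g x); [exists g|rewrite gc].
Qed.

Lemma orbits_adj i (O : set_type (@flag_orbits n M)) :
  adj i @` val O \in @flag_orbits n M.
Proof.
have /set_mem[x ->] := valP O; apply/mem_set.
by exists (adj i x); rewrite image_adj_orbit.
Qed.

(* O^{r_i}: by image_adj_orbit, the orbit containing the i-adjacent flag of
   any flag in O. *)
Definition orbit_adj i (O : set_type (@flag_orbits n M)) : set_type (@flag_orbits n M) :=
  exist _ (adj i @` val O) (orbits_adj i O).

Lemma orbit_adjK i : involutive (orbit_adj i).
Proof.
move=> O; apply: val_inj; rewrite /= image_comp.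
have -> : adj i \o adj i = @id (flag M) by apply/funext => x /=; rewrite adjK.
exact: image_id.
Qed.

Definition stg_rev (d : set_type (@flag_orbits n M) * 'I_n) :
  set_type (@flag_orbits n M) * 'I_n := (orbit_adj d.2 d.1, d.2).

Lemma stg_revK : involutive stg_rev.
Proof. by case=> O i; rewrite /stg_rev /= orbit_adjK. Qed.

(* Each orbit O is the origin of exactly one dart (O, i) of each colour i. *)
Definition symmetry_type_graph : cpregraph 'I_n :=
  @CPregraph 'I_n (set_type (@flag_orbits n M)) (set_type (@flag_orbits n M) * 'I_n)
    fst stg_rev snd stg_revK (fun=> erefl).

End SymmetryTypeGraph.

Section TwoVertexGraph.
Variables (n : nat) (I : {set 'I_n}).

Definition two_rev (d : bool * 'I_n) : bool * 'I_n :=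
  (if d.2 \in I then d.1 else ~~ d.1, d.2).

Lemma two_revK : involutive two_rev.
Proof. by case=> b i; rewrite /two_rev /=; case: (i \in I); rewrite ?negbK. Qed.

(* The pregraph 2_I^n; its two vertices are the booleans. *)
Definition two_graph : cpregraph 'I_n :=
  @CPregraph 'I_n bool (bool * 'I_n) fst two_rev snd two_revK (fun=> erefl).

End TwoVertexGraph.

Definition of_type_two n (M : maniplex n) (I : {set 'I_n}) : Prop :=
  cpregraph_iso (symmetry_type_graph M) (two_graph I).

(* Main.v *)
(* Let W be the group generated by involutions r_i, i < n, with r_i r_j = r_j r_i
   for |i - j| >= 2. Let W act on a set Y with two colour classes, exchanged by
   r_i for i not in I and preserved by r_i for i in I, and suppose that some w
   in W, with every r_i occurring an even number of times, acts trivially on one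
   class but not on the other. Record for each word its restriction to the first
   class and the parities of its letters. These records are the flags of a
   maniplex: the parities make it non-degenerate, the words preserving the colours
   give automorphisms with two orbits, and w shows that no automorphism fuses them.

   To construct Y, fix t not in I, and permutations s_i (i <> t) of a finite set X
   such that s_i is odd exactly when i is not in I, the s_i with |i - t| >= 2 fix a
   point p, and the orbit of p is X. Put Y = Sym(X) * Q * {0,1}: r_i multiplies
   the permutation pi by s_i, and r_t exchanges the two copies of the line over pi
   by an affine map depending only on pi(p); the colour combines the sign of pi
   with the last coordinate. Conjugates of r_t realise the affine map attached to
   pi(q) for each q in X. The words acting by translations of the lines over
   (pi, c) form a module over the ring generated by the ratios of slopes; as these
   ratios separate (1, 0) from all other (pi, c), interpolation yields a word that
   moves only the line over (1, 0).

   For s_i one takes a path whose edge labels form a walk on the indices on one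
   side of t, starting next to t and visiting i an odd number of times exactly
   when i is not in I. This needs two indices on that side, with all indices of
   the other side in I, and so leaves only n = 3 with I = {0, 2}, where the Klein
   four-group acting on itself works. *)
Require Import Defs.
From mathcomp Require Import all_boot.
From mathcomp Require Import all_fingroup all_algebra.
From mathcomp Require Import boolp classical_sets.
From mathcomp Require Import zify ring.

Set Implicit Arguments.
Unset Strict Implicit.
Unset Printing Implicit Defensive.

(** * Maniplexes from two-coloured actions *)

Section ManiplexOfAction.
Variables (n : nat) (I : {set 'I_n}) (Y : Type) (r : 'I_n -> Y -> Y).
Variables (col : Y -> bool).
Hypothesis rK : forall i, involutive (r i).
Hypothesis rC : forall (i j : 'I_n) y, (2 <= `|i - j|)%N ->
  r i (r j y) = r j (r i y).
Hypothesis col_r : forall i y, col (r i y) = (i \notin I) (+) col y.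

Definition act (w : seq 'I_n) (y : Y) : Y := foldr r y w.

Lemma act_cat u v y : act (u ++ v) y = act u (act v y).
Proof. exact: foldr_cat. Qed.

Lemma act_revK w : cancel (act w) (act (rev w)).
Proof.
elim: w => [|i w IHw] y //=.
by rewrite rev_cons -cats1 act_cat /= rK.
Qed.

Lemma actK_rev w : cancel (act (rev w)) (act w).
Proof. by move=> y; rewrite -{1}[w]revK act_revK. Qed.

Definition word_colour (w : seq 'I_n) : bool := odd (count [pred i | i \notin I] w).

Lemma word_colour_cat u v :
  word_colour (u ++ v) = word_colour u (+) word_colour v.
Proof. by rewrite /word_colour count_cat oddD. Qed.

Lemma word_colour_rev w : word_colour (rev w) = word_colour w.
Proof. by rewrite /word_colour count_rev. Qed.

Lemma col_act w y : col (act w y) = word_colour w (+) col y.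
Proof.
elim: w => //= i w IHw; rewrite col_r IHw /word_colour /=.
by rewrite addbA oddD oddb.
Qed.

Definition parity (w : seq 'I_n) : {ffun 'I_n -> bool} :=
  [ffun i => odd (count_mem i w)].

Lemma parity_cat u v i : parity (u ++ v) i = parity u i (+) parity v i.
Proof. by rewrite !ffunE count_cat oddD. Qed.

Lemma parity_rev w : parity (rev w) = parity w.
Proof. by apply/ffunP=> i; rewrite !ffunE count_rev. Qed.

(* The junk value [y] outside the colour class makes [action_flag] extensional. *)
Definition restriction (w : seq 'I_n) : (Y -> Y) * {ffun 'I_n -> bool} :=
  (fun y => if col y then y else act w y, parity w).

Definition action_flag := {F | exists w, F = restriction w}.

Definition word_flag w : action_flag :=
  exist _ (restriction w) (ex_intro _ w erefl).

Lemma action_flag_inj (F G : action_flag) : sval F = sval G -> F = G.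
Proof. by case: F G => [F hF] [G hG] /= ?; apply: eq_exist. Qed.

Lemma action_flagP (F : action_flag) : exists w, F = word_flag w.
Proof. by case: F => F [w hw]; exists w; apply: action_flag_inj. Qed.

Lemma word_flag_eq u v :
  (forall y, col y = false -> act u y = act v y) -> parity u = parity v ->
  word_flag u = word_flag v.
Proof.
move=> huv hp; apply: action_flag_inj; rewrite /= /restriction hp.
by congr (_, _); apply/funext => y; case: ifP => // /huv.
Qed.

Lemma word_flag_act u v y : word_flag u = word_flag v -> col y = false ->
  act u y = act v y.
Proof. by case=> /(congr1 (@^~ y)) /= + _ hy; rewrite hy. Qed.

Lemma word_flag_parity u v : word_flag u = word_flag v -> parity u = parity v.
Proof. by case=> _ ->. Qed.

Lemma restriction_cons i w : restriction (i :: w) =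
  (fun y => if col y then y else r i ((restriction w).1 y),
   [ffun j => (i == j) (+) (restriction w).2 j]).
Proof.
apply: (f_equal2 pair); first by apply/funext => y /=; case: ifP.
by apply/ffunP=> j; rewrite !ffunE /= oddD oddb.
Qed.

Lemma flag_step_subproof i (F : action_flag) : exists w,
  (fun y => if col y then y else r i ((sval F).1 y),
   [ffun j => (i == j) (+) (sval F).2 j]) = restriction w.
Proof. by have [w ->] := action_flagP F; exists (i :: w); rewrite restriction_cons. Qed.

Definition flag_step i F : action_flag :=
  exist _ _ (flag_step_subproof i F).

Lemma flag_step_word i w : flag_step i (word_flag w) = word_flag (i :: w).
Proof. by apply: action_flag_inj; rewrite [RHS]restriction_cons. Qed.

Lemma foldr_flag_step u w :
  foldr flag_step (word_flag w) u = word_flag (u ++ w).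
Proof. by elim: u => //= i u ->; rewrite flag_step_word. Qed.

Lemma flag_stepK i : involutive (flag_step i).
Proof.
move=> F; have [w ->] := action_flagP F; rewrite !flag_step_word.
apply: word_flag_eq => [y _|]; first by rewrite /= rK.
by apply/ffunP=> j; rewrite !ffunE /= !oddD addbA addbb.
Qed.

Lemma flag_step_fixfree i F : flag_step i F <> F.
Proof.
have [w ->] := action_flagP F; rewrite flag_step_word.
move=> /word_flag_parity/ffunP/(_ i); rewrite !ffunE /= eqxx add1n /=.
by case: odd.
Qed.

Lemma flag_step_neq i j F : i != j -> flag_step i F <> flag_step j F.
Proof.
have [w ->] := action_flagP F; rewrite !flag_step_word => /negPf nij.
move=> /word_flag_parity/ffunP/(_ i); rewrite !ffunE /= eqxx add1n /=.
by rewrite eq_sym nij add0n; case: odd.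
Qed.

Lemma flag_step_comm (i j : 'I_n) F : (2 <= `|i - j|)%N ->
  flag_step i (flag_step j F) = flag_step j (flag_step i F).
Proof.
have [w ->] := action_flagP F; rewrite !flag_step_word => ij.
apply: word_flag_eq => [y _|]; first by rewrite /= rC.
by apply/ffunP=> k; rewrite !ffunE /= !oddD !addbA [X in X (+) _]addbC.
Qed.

Lemma flag_step_trans F G : exists2 w, Defs.generated flag_step w & w F = G.
Proof.
have [[u ->] [v ->]] := (action_flagP F, action_flagP G).
exists (fun F => foldr flag_step F (v ++ rev u)).
  elim: (v ++ rev u) => [|i w IHw] /=; first exact: generated_id.
  exact: (generated_comp (generated_base _ i) IHw).
rewrite foldr_flag_step -catA; apply: word_flag_eq => [y _|].
  by rewrite !act_cat act_revK.
by apply/ffunP=> k; rewrite !parity_cat parity_rev addbb addbF.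
Qed.

Definition action_maniplex : maniplex n :=
  Maniplex (inhabits (word_flag [::])) flag_stepK flag_step_fixfree
    flag_step_trans flag_step_neq flag_step_comm.

(** As [u] preserves the colours, the record of [w ++ u] depends on [w] only through its record;
    hence right multiplication by [u] is well defined on flags. *)
Lemma restriction_cat w u : word_colour u = false -> restriction (w ++ u) =
  (fun y => if col y then y else (restriction w).1 (act u y),
   [ffun j => (restriction w).2 j (+) parity u j]).
Proof.
move=> hu; apply: (f_equal2 pair).
  by apply/funext => y /=; case: ifP => // hy; rewrite col_act hu hy act_cat.
by apply/ffunP=> j; rewrite parity_cat [RHS]ffunE.
Qed.

Lemma flag_shift_subproof u (hu : word_colour u = false) (F : action_flag) :
  exists w, (fun y => if col y then y else (sval F).1 (act u y),
   [ffun j => (sval F).2 j (+) parity u j]) = restriction w.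
Proof.
by have [w ->] := action_flagP F; exists (w ++ u); rewrite restriction_cat.
Qed.

Definition flag_shift u hu F : action_flag :=
  exist _ _ (@flag_shift_subproof u hu F).

Lemma flag_shift_word u hu w :
  @flag_shift u hu (word_flag w) = word_flag (w ++ u).
Proof. by apply: action_flag_inj; rewrite [RHS]restriction_cat. Qed.

Lemma flag_shift_automorphism u hu :
  automorphism (M := action_maniplex) (@flag_shift u hu).
Proof.
have hu' : word_colour (rev u) = false by rewrite word_colour_rev.
split.
  exists (@flag_shift (rev u) hu') => F; have [w ->] := action_flagP F;
    rewrite !flag_shift_word -catA; (apply: word_flag_eq => [y _|];
    [by rewrite !act_cat ?act_revK ?actK_rev|]);
    by apply/ffunP=> j; rewrite !parity_cat parity_rev addbb addbF.
move=> i F; have [w ->] := action_flagP F.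
by rewrite /= flag_step_word !flag_shift_word flag_step_word.
Qed.

Lemma same_colour_orbit u v : word_colour u = word_colour v ->
  flag_orbit (M := action_maniplex) (word_flag u) (word_flag v).
Proof.
move=> huv; have hw : word_colour (rev u ++ v) = false.
  by rewrite word_colour_cat word_colour_rev huv addbb.
exists (flag_shift hw); first exact: flag_shift_automorphism.
rewrite flag_shift_word; apply: word_flag_eq => [y _|].
  by rewrite !act_cat actK_rev.
by apply/ffunP=> j; rewrite !parity_cat parity_rev addbA addbb.
Qed.

Variables (i0 : 'I_n) (w0 : seq 'I_n) (y1 : Y).
Hypothesis i0I : i0 \notin I.
Hypothesis w0_parity : parity w0 = parity [::].
Hypothesis w0_trivial : forall y, col y = false -> act w0 y = y.
Hypothesis y1_col : col y1.
Hypothesis w0_moves : act w0 y1 <> y1.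

(* [w0] fixes the base flag; were [v] in its orbit, [w0] would also fix
   [word_flag v], whose entries are the points of the other colour class. *)
Lemma orbit_same_colour u v :
  flag_orbit (M := action_maniplex) (word_flag u) (word_flag v) ->
  word_colour u = word_colour v.
Proof.
move=> [g [_ gC] guv]; apply/eqP; rewrite -negb_add; apply/negP=> huv.
have gfold w F : g (foldr flag_step F w) = foldr flag_step (g F) w.
  by elim: w => //= i w <-; rewrite (gC i).
set v' := rev u ++ v.
have hv' : word_colour v' by rewrite word_colour_cat word_colour_rev.
have base : word_flag [::] = foldr flag_step (word_flag u) (rev u).
  rewrite foldr_flag_step; apply: word_flag_eq => [y _|].
    by rewrite act_cat act_revK.
  by apply/ffunP=> j; rewrite parity_cat parity_rev addbb ffunE.
have gbase : g (word_flag [::]) = word_flag v'.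
  by rewrite base gfold guv foldr_flag_step.
have fixbase : foldr flag_step (word_flag [::]) w0 = word_flag [::].
  rewrite foldr_flag_step cats0; exact: word_flag_eq.
have := gfold w0 (word_flag [::]); rewrite fixbase gbase foldr_flag_step.
(* [v'] exchanges the classes, so [act (rev v') y1] lies in the class [col = false], and [v'] sends
   it to [y1]. *)
move=> /(@word_flag_act _ _ (act (rev v') y1)).
rewrite col_act word_colour_rev hv' y1_col => /(_ erefl).
by rewrite act_cat actK_rev => /esym.
Qed.

Let base_point := r i0 y1.

Let base_point_col : col base_point = false.
Proof. by rewrite col_r i0I y1_col. Qed.

(** A flag does not contain its word, but the image of one point of the first class reveals the
    colour of that word. *)
Let flag_colour (F : action_flag) : bool := col ((sval F).1 base_point).

Let flag_colour_word w : flag_colour (word_flag w) = word_colour w.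
Proof. by rewrite /flag_colour /= base_point_col col_act base_point_col addbF. Qed.

Let orbitE (F G : action_flag) :
  flag_orbit (M := action_maniplex) F G <-> flag_colour F = flag_colour G.
Proof.
have [[u ->] [v ->]] := (action_flagP F, action_flagP G).
rewrite !flag_colour_word.
by split; [apply: orbit_same_colour | apply: same_colour_orbit].
Qed.

Lemma action_maniplex_type_two : of_type_two action_maniplex I.
Proof.
pose vert := set_type (@flag_orbits n action_maniplex).
have orbP (O : vert) : exists F, val O = flag_orbit (M := action_maniplex) F.
  by have /set_mem[F ->] := valP O; exists F.
pose rp O := sval (cid (orbP O)).
have rpE O : val O = flag_orbit (rp O) := svalP (cid (orbP O)).
pose fV O := flag_colour (rp O).
have orbit_in (F : flag action_maniplex) :
  flag_orbit F \in @flag_orbits n action_maniplex by apply/mem_set; exists F.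
pose orb F : vert := exist _ (flag_orbit F) (orbit_in F).
have orbit_eq (F G : flag action_maniplex) : flag_colour F = flag_colour G ->
    flag_orbit F = flag_orbit G.
  by move=> hFG; apply/seteqP; split=> H /orbitE hH; apply/orbitE; rewrite -hH.
have fV_val (O : vert) F : val O = flag_orbit F -> fV O = flag_colour F.
  by move=> hO; apply/orbitE; rewrite -rpE hO; apply/orbitE.
pose gV b := orb (word_flag (if b then [:: i0] else [::])).
have fVK : cancel fV gV.
  move=> O; apply: val_inj; rewrite /= rpE; apply: orbit_eq.
  rewrite flag_colour_word /fV; case: (flag_colour (rp O)) => //.
  by rewrite /word_colour /= i0I.
have gVK : cancel gV fV.
  move=> b; rewrite (@fV_val (gV b) _ erefl) flag_colour_word.
  by case: b; rewrite /word_colour //= i0I.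
exists fV, (fun d => (fV d.1, d.2)); split => //.
- by exists gV.
- by exists (fun d => (gV d.1, d.2)) => -[a b] /=; rewrite ?fVK ?gVK.
- case=> O i /=; rewrite /two_rev /=; congr (_, _).
  have [w hw] := action_flagP (rp O).
  have -> : fV (orbit_adj i O) = flag_colour (word_flag (i :: w)).
    apply: fV_val; transitivity (adj i @` val O)%classic => //.
    by rewrite rpE image_adj_orbit hw /= flag_step_word.
  rewrite /fV hw !flag_colour_word /word_colour /= oddD oddb.
  by case: (i \in I).
Qed.

End ManiplexOfAction.

(** * Actions by affine maps *)

Local Open Scope ring_scope.
Import GRing.Theory Num.Theory.

(** Linear part, on the line over [z], of crossing by [q] and then by [q']; the constant term is
    [ratio_shift]. *)
Definition slope_ratio m (slope : 'I_m -> rat) q q' (z : 'S_m * bool) : rat :=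
  if z.2 then slope (z.1 q') / slope (z.1 q) else slope (z.1 q) / slope (z.1 q').

Definition ratio_shift m (slope offset : 'I_m -> rat) q q' (z : 'S_m * bool) : rat :=
  if z.2 then offset (z.1 q') - slope (z.1 q') * offset (z.1 q) / slope (z.1 q)
  else (offset (z.1 q) - offset (z.1 q')) / slope (z.1 q').

Section AffineFibres.
Variables (n : nat) (I : {set 'I_n}) (t : 'I_n).
Variables (m : nat) (s : 'I_n -> 'S_m) (p : 'I_m).
Hypothesis tI : t \notin I.
Hypothesis sK : forall i, i != t -> (s i * s i = 1)%g.
Hypothesis sC : forall i j : 'I_n, i != t -> j != t -> (2 <= `|i - j|)%N ->
  (s i * s j = s j * s i)%g.
Hypothesis sp : forall i : 'I_n, (2 <= `|i - t|)%N -> s i p = p.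
Hypothesis s_odd : forall i, i != t -> s i = (i \notin I) :> bool.
Hypothesis s_orbit : forall R : 'I_m -> Prop, R p ->
  (forall i q, i != t -> R q -> R (s i q)) -> forall q, R q.
Variables slope offset : 'I_m -> rat.
Hypothesis slope_neq0 : forall q, slope q != 0.

Let point : Type := 'S_m * rat * bool.

Let cross (q : 'I_m) (y : point) : point :=
  let: (pi, x, c) := y in
  if c then (pi, (x - offset q) / slope q, false)
  else (pi, slope q * x + offset q, true).

Let crossK q : involutive (cross q).
Proof.
by move=> [[pi x] []] /=; congr (_, _, _); field; exact: slope_neq0.
Qed.

(** In [s i * pi] the factor [s i] acts first, so [pi p] becomes [pi (s i p)]; when [s i] fixes [p],
    [r i] commutes with [r t]. *)
Let r (i : 'I_n) (y : point) : point :=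
  if i == t then cross (y.1.1 p) y else (s i * y.1.1, y.1.2, y.2)%g.

Let col (y : point) : bool := (y.1.1 : bool) (+) ~~ y.2.

Let rK i : involutive (r i).
Proof.
move=> [[pi x] c]; rewrite /r; case: eqVneq => [_|it] /=.
  by case: c; rewrite -[RHS](crossK (pi p)).
by rewrite mulgA sK // mul1g.
Qed.

Let rC (i j : 'I_n) y : (2 <= `|i - j|)%N -> r i (r j y) = r j (r i y).
Proof.
case: y => [[pi x] c] ij; rewrite /r.
case: (eqVneq i t) => [it|it]; case: (eqVneq j t) => [jt|jt] //=.
- by rewrite permM sp; [case: c | rewrite -it distnC].
- by rewrite permM sp -?jt //; case: c.
- by rewrite !mulgA sC.
Qed.

Let col_r i y : col (r i y) = (i \notin I) (+) col y.
Proof.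
case: y => [[pi x] c]; rewrite /r /col.
case: eqVneq => [->|it]; first by rewrite tI; case: c => /=; case: (pi : bool).
by rewrite /= odd_permM s_odd // addbA.
Qed.

Let cross_word q : exists w, forall pi x c,
  act r w (pi, x, c) = cross (pi q) (pi, x, c).
Proof.
move: q; apply: s_orbit => [|i q it [w hw]].
  by exists [:: t] => pi x c; rewrite /= /r eqxx.
exists (i :: w ++ [:: i]) => pi x c.
have rE pi' x' c' : r i (pi', x', c') = (s i * pi', x', c')%g.
  by rewrite /r (negPf it).
rewrite /= act_cat /= rE hw permM.
by case: c => /=; rewrite rE mulgA sK // mul1g.
Qed.

Let realizes w (l b : 'S_m * bool -> rat) := forall pi x c,
  act r w (pi, x, c) = (pi, l (pi, c) * x + b (pi, c), c).

Let realizes_ext w l b l' b' : l =1 l' -> b =1 b' ->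
  realizes w l b -> realizes w l' b'.
Proof. by move=> hl hb h pi x c; rewrite h hl hb. Qed.

Let realizes_cat u v l b l' b' : realizes u l b -> realizes v l' b' ->
  realizes (u ++ v) (fun z => l z * l' z) (fun z => l z * b' z + b z).
Proof.
move=> hu hv pi x c; rewrite act_cat hv hu.
by congr (_, _, _); ring.
Qed.

Let realizes_rev w l b : (forall z, l z != 0) -> realizes w l b ->
  realizes (rev w) (fun z => (l z)^-1) (fun z => - b z / l z).
Proof.
move=> l0 hw pi x c.
have {1}-> : (pi, x, c) = act r w (pi, (l (pi, c))^-1 * x - b (pi, c) / l (pi, c), c).
  by rewrite hw; congr (_, _, _); field.
by rewrite act_revK // mulNr.
Qed.

Let ratio := slope_ratio slope.
Let shift := ratio_shift slope offset.

Let ratio_neq0 q q' z : ratio q q' z != 0.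
Proof. by rewrite /ratio /slope_ratio; case: ifP => _; rewrite mulf_neq0 ?invr_eq0. Qed.

Let pair_word q q' : exists w, realizes w (ratio q q') (shift q q').
Proof.
have [[u hu] [v hv]] := (cross_word q, cross_word q').
exists (v ++ u) => pi x c; rewrite act_cat hu.
by case: c => /=; rewrite hv /= /ratio /shift /slope_ratio /ratio_shift /=;
  congr (_, _, _); field.
Qed.

Let translation k := exists w, realizes w (fun=> 1) k.

Let translation_ext k k' : k =1 k' -> translation k -> translation k'.
Proof. by move=> hk [w hw]; exists w; apply: realizes_ext hw. Qed.

Let translationD k k' : translation k -> translation k' ->
  translation (fun z => k z + k' z).
Proof.
move=> [w hw] [w' hw']; exists (w ++ w').
by apply: realizes_ext (realizes_cat hw hw') => z; ring.
Qed.

Let translationN k : translation k -> translation (fun z => - k z).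
Proof.
move=> [w hw]; exists (rev w).
apply: realizes_ext (realizes_rev _ hw) => z; first by rewrite invr1.
  by rewrite divr1.
by rewrite oner_neq0.
Qed.

Let translationMz k (a : int) : translation k -> translation (fun z => k z *~ a).
Proof.
move=> hk; have hn : forall j : nat, translation (fun z => k z *+ j).
  elim=> [|j IHj]; first by exists [::] => pi x c; rewrite mulr0n addr0 mul1r.
  by apply: translation_ext (translationD hk IHj) => z; rewrite mulrS.
by case: a => j; [exact: hn | exact: translationN (hn j.+1)].
Qed.

(** Conjugating a translation by an affine map multiplies it by the slope. *)
Let translation_ratio q q' k : translation k ->
  translation (fun z => ratio q q' z * k z).
Proof.
move=> [w hw]; have [g hg] := pair_word q q'; exists (g ++ w ++ rev g).
have hgV := realizes_rev (ratio_neq0 q q') hg.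
apply: realizes_ext (realizes_cat hg (realizes_cat hw hgV)) => z.
  by rewrite mul1r mulfV.
by field; exact: ratio_neq0.
Qed.

Variable target : 'S_m * bool.
Hypothesis separates : forall z, z != target ->
  exists q q', ratio q q' z != ratio q q' target.
Hypothesis noncommuting : exists q q' q'',
  (ratio q q'' target - 1) * shift q' q'' target !=
  (ratio q' q'' target - 1) * shift q q'' target.

(** The commutator of x -> a x + b and x -> a' x + b' translates by (a - 1) b' - (a' - 1) b. *)
Let commutator_translation : exists2 k, translation k & k target != 0.
Proof.
have [q [q' [q'' ne]]] := noncommuting.
have [[g hg] [h hh]] := (pair_word q q'', pair_word q' q'').
have hV := realizes_rev
  (fun z => mulf_neq0 (ratio_neq0 q' q'' z) (ratio_neq0 q q'' z))
  (realizes_cat hh hg).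
exists (fun z => (ratio q q'' z - 1) * shift q' q'' z -
                 (ratio q' q'' z - 1) * shift q q'' z); last by rewrite subr_eq0.
exists ((g ++ h) ++ rev (h ++ g)).
apply: realizes_ext (realizes_cat (realizes_cat hg hh) hV) => z /=.
  by field; rewrite !ratio_neq0.
by field; rewrite !ratio_neq0.
Qed.

(* Interpolation: multiplying by [ratio q q' - ratio q q' z] kills the value at
   [z] and keeps the one at [target]. *)
Let delta_translation (zs : seq ('S_m * bool)) : exists k,
  [/\ translation k, k target != 0 &
      forall z, z \in zs -> z != target -> k z = 0].
Proof.
elim: zs => [|z zs [k [hk k0 kz]]].
  by have [k hk k0] := commutator_translation; exists k.
have [->|zt] := eqVneq z target.
  exists k; split=> // z'; rewrite inE => /predU1P[->|/kz //].
  by rewrite eqxx.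
have [q [q' ne]] := separates zt.
move zv: (ratio q q' z) ne => v ne.
(* Words give only integer multiples, so the factor is cleared of the denominator of [v]. *)
exists (fun z => ratio q q' z * k z *~ denq v - k z *~ numq v).
have E z' : ratio q q' z' * k z' *~ denq v - k z' *~ numq v =
    (ratio q q' z' - v) * k z' * (denq v)%:~R.
  have dE : (numq v)%:~R = v * (denq v)%:~R.
    by rewrite -{2}[v]divq_num_den divfK // intr_eq0 denq_neq0.
  rewrite -[in LHS]mulrzr -[k z' *~ _]mulrzr dE.
  by move: (ratio q q' z') (k z') (_%:~R) => a x d; ring.
split.
- apply: translationD; first exact: translationMz (translation_ratio q q' hk).
  exact: translationN (translationMz _ hk).
- by rewrite E !mulf_neq0 ?intr_eq0 ?denq_neq0 // subr_eq0 eq_sym.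
- move=> z'; rewrite inE E => /predU1P[->|/kz h /h ->].
    by rewrite zv subrr !mul0r.
  by rewrite mulr0 mul0r.
Qed.

Hypothesis target_col : (target.1 : bool) (+) ~~ target.2.

Lemma affine_type_two : exists M : maniplex n, of_type_two M I.
Proof.
have [k [[w hw] k0 kz]] := delta_translation (enum {: 'S_m * bool}).
(* Doubling [w] makes all letter parities even, and the translation stays non-zero at [target]. *)
have hww : forall pi x c, act r (w ++ w) (pi, x, c) = (pi, x + k (pi, c) *+ 2, c).
  by move=> pi x c; rewrite act_cat !hw !mul1r mulr2n addrA.
exists (action_maniplex col rK rC).
apply: (action_maniplex_type_two rK rC col_r tI (w0 := w ++ w)
          (y1 := (target.1, 0, target.2))) => //.
- by apply/ffunP=> i; rewrite parity_cat addbb ffunE.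
- case=> [[pi x] c]; rewrite hww /col /= => hcol.
  rewrite kz ?mul0rn ?addr0 ?mem_enum //.
  by apply: contraFN hcol => /eqP e; move: target_col; rewrite -e.
- rewrite hww add0r => -[/eqP]; rewrite mulrn_eq0 /= -surjective_pairing.
  by rewrite (negPf k0).
Qed.

End AffineFibres.

(** * The slopes 1, ..., m and their ratios *)

Definition succ_slope m (q : 'I_m) : rat := q.+1%:R.

Lemma succ_slope_neq0 m (q : 'I_m) : succ_slope q != 0.
Proof. by rewrite pnatr_eq0. Qed.

(** Suppose that all ratios agree. If [z.2] is true, (pi q + 1)(q + 1) is constant; the first and
    last points force the value m, which m - 1 does not divide as m > 2. If [z.2] is false, (pi q +
    1)/(q + 1) is constant, and summing over the points shows that it is 1. *)
Lemma succ_slope_ratio_separates m (z : 'S_m * bool) : (2 < m)%N ->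
  z != (1%g, false) ->
  exists q q', slope_ratio (@succ_slope m) q q' z !=
               slope_ratio (@succ_slope m) q q' (1%g, false).
Proof.
case: m z => // m [pi c] m_gt2 hz; apply: contrapT => H.
have E (q q' : 'I_m.+1) : if c then ((pi q').+1 * q'.+1 = (pi q).+1 * q.+1)%N
    else ((pi q).+1 * q'.+1 = q.+1 * (pi q').+1)%N.
  have /eqP : slope_ratio (@succ_slope _) q q' (pi, c) =
              slope_ratio (@succ_slope _) q q' (1%g, false).
    by apply/eqP/negPn/negP => ne; apply: H; exists q, q'.
  rewrite /slope_ratio /= !perm1.
  by case: c {hz H}; rewrite eqr_div ?succ_slope_neq0 // -!natrM eqr_nat => /eqP //; lia.
case: c hz E {H} => [_|hz] E.
  have hm : (m.-1 < m.+1)%N by lia.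
  have := (E ord0 ord_max, E (Ordinal hm) ord_max); rewrite /= => -[].
  have := (ltn_ord (pi ord0), ltn_ord (pi ord_max), ltn_ord (pi (Ordinal hm))).
  move: (pi ord0 : nat) (pi ord_max : nat) (pi (Ordinal hm) : nat) => a b d.
  case=> -[ha hb hd]; case: b hb => [|b] hb; last by nia.
  rewrite mul1n => _; case: d hd => [|[|d]] hd; nia.
have sum_gt0 : (0 < \sum_(q < m.+1) q.+1)%N by rewrite big_ord_recl.
case/eqP: hz; congr (_, _); apply/permP => q; apply/val_inj; rewrite perm1.
have : (\sum_q' (pi q').+1 * q.+1 = \sum_(q' < m.+1) q'.+1 * (pi q).+1)%N.
  by apply: eq_bigr => q' _; exact: E.
rewrite -!big_distrl /= (reindex_inj (@perm_inj _ pi^-1%g)) /=.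
under eq_bigr => i _ do rewrite permKV.
by move=> /eqP; rewrite eqn_pmul2l // => /eqP[].
Qed.

Section PermutationData.
Variables (n : nat) (I : {set 'I_n}) (t : 'I_n).
Variables (m : nat) (s : 'I_n -> 'S_m) (p : 'I_m).
Hypothesis m_gt2 : (2 < m)%N.
Hypothesis tI : t \notin I.
Hypothesis sK : forall i, i != t -> (s i * s i = 1)%g.
Hypothesis sC : forall i j : 'I_n, i != t -> j != t -> (2 <= `|i - j|)%N ->
  (s i * s j = s j * s i)%g.
Hypothesis sp : forall i : 'I_n, (2 <= `|i - t|)%N -> s i p = p.
Hypothesis s_odd : forall i, i != t -> s i = (i \notin I) :> bool.
Hypothesis s_orbit : forall R : 'I_m -> Prop, R p ->
  (forall i q, i != t -> R q -> R (s i q)) -> forall q, R q.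

Lemma permutation_type_two : exists M : maniplex n, of_type_two M I.
Proof.
apply: (affine_type_two tI sK sC sp s_odd s_orbit (@succ_slope_neq0 m)
  (offset := fun q => (q == 2 :> nat)%:R) (target := (1%g, false))).
- by move=> z; exact: succ_slope_ratio_separates.
- pose q k (hk : (k < 3)%N) : 'I_m := Ordinal (leq_trans hk m_gt2).
  (* Over the target the two maps are x -> 2x and x -> 3x + 1, which do not commute. *)
  exists (q 1%N isT), (q 2%N isT), (q 0%N isT).
  by rewrite /slope_ratio /ratio_shift /succ_slope /= !perm1.
- by rewrite /= odd_perm1.
Qed.

End PermutationData.

(** * Permutations from labelled paths *)

(* [path_perm l e] acts on the vertices [0], ..., [size l] of a path whose
   consecutive edges are labelled by [l]: it swaps the ends of the edges
   labelled [e]. *)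
Fixpoint path_perm (l : seq nat) (e : nat) : 'S_(size l).+1 :=
  if l is d :: l' then
    ((if e == d then tperm ord0 (lift ord0 ord0) else 1) *
     lift_perm ord0 ord0 (path_perm l' e))%g
  else 1%g.

Definition near (a b : nat) := (a == b.+1) || (b == a.+1).

Lemma path_perm_fix0 (c : nat) l (e : nat) : path near c l -> (2 <= `|e - c|)%N || (e == c) ->
  path_perm l e ord0 = ord0.
Proof.
case: l => [|d l] /=; first by rewrite perm1.
case/andP=> hd _ he; have -> : (e == d) = false by move: hd he; rewrite /near; lia.
by rewrite mul1g lift_perm_id.
Qed.

(** The edge after the one labelled [d] does not carry the label [e], so the second factor fixes
    both ends of the first edge. *)
Lemma path_perm_tperm (d : nat) l (e : nat) : path near d l -> (2 <= `|e - d|)%N || (e == d) ->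
  commute (tperm ord0 (lift ord0 ord0)) (lift_perm ord0 ord0 (path_perm l e)).
Proof.
move=> hl he; apply/commgP/conjg_fixP; rewrite tpermJ lift_perm_id.
by rewrite lift_perm_lift (path_perm_fix0 hl).
Qed.

(** Consecutive labels differ, so the edges with a given label are disjoint. *)
Lemma path_permK c l e : path near c l -> (path_perm l e * path_perm l e = 1)%g.
Proof.
elim: l c => [|d l IHl] c /=; first by rewrite mulg1.
case/andP=> _ hl; have IH := IHl _ hl.
have LL : (lift_perm ord0 ord0 (path_perm l e) * lift_perm ord0 ord0 (path_perm l e)
  = 1)%g by rewrite lift_permM IH lift_perm1.
case: eqP => [->|_] in IH LL *; last by rewrite mul1g.
have cTL : commute (tperm ord0 (lift ord0 ord0))
                   (lift_perm ord0 ord0 (path_perm l d)).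
  by apply: (path_perm_tperm hl); rewrite eqxx orbT.
rewrite -[LHS]/(_ ^+ 2)%g expgMn //.
by rewrite (_ : tperm _ _ ^+ 2 = 1)%g ?mul1g ?LL //; exact: tperm2.
Qed.

(** Consecutive labels differ by exactly 1, so no edge labelled [e] meets one labelled [f]. *)
Lemma path_permC c l (e f : nat) : path near c l -> (2 <= `|e - f|)%N ->
  commute (path_perm l e) (path_perm l f).
Proof.
move=> hl hef; elim: l c hl => [|d l IHl] c /=; first by move=> _; exact: commute1.
case/andP=> _ hl; have IH := IHl _ hl.
have LL : commute (lift_perm ord0 ord0 (path_perm l e))
                  (lift_perm ord0 ord0 (path_perm l f)).
  by rewrite /commute !lift_permM IH.
case: eqP => [ed|_]; case: eqP => [fd|_]; rewrite ?mul1g //.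
- by move: hef; rewrite ed fd distnn.
- apply/commute_sym/commuteM; apply/commute_sym => //.
  by apply: (path_perm_tperm hl); rewrite -ed distnC hef.
- apply: commuteM => //; apply: commute_sym.
  by apply: (path_perm_tperm hl); rewrite -fd hef.
Qed.

Lemma odd_path_perm l e : path_perm l e = odd (count_mem e l) :> bool.
Proof.
elim: l => [|d l IHl] /=; first by rewrite odd_perm1.
rewrite odd_permM odd_lift_perm IHl oddD oddb eq_sym.
by case: eqP => _; rewrite ?odd_tperm ?odd_perm1.
Qed.

Lemma path_perm_orbit c l (R : 'I_(size l).+1 -> Prop) : path near c l -> R ord0 ->
  (forall e q, e \in l -> R q -> R (path_perm l e q)) -> forall q, R q.
Proof.
elim: l c R => [|d l IHl] c R /=; first by move=> _ R0 _ q; rewrite ord1.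
case/andP=> _ hl R0 hR.
have lift0E : lift_perm ord0 ord0 (path_perm l d) (lift ord0 ord0) = lift ord0 ord0.
  by rewrite lift_perm_lift (path_perm_fix0 hl) ?eqxx ?orbT.
have R1 : R (lift ord0 ord0).
  by have := hR d _ (mem_head _ _) R0; rewrite eqxx permM tpermL lift0E.
have {}IHl : forall q, R (lift ord0 q).
  apply: (IHl d (fun q => R (lift ord0 q)) hl R1) => e q el hq.
  (* For the label [d] the permutation of the whole path also swaps 0 and 1; on the tail it differs
     from that of the tail only at the vertex 1, which the latter fixes. *)
  have [->|ne] := eqVneq e d.
    have [->|q0] := eqVneq q ord0; first by rewrite (path_perm_fix0 hl) ?eqxx ?orbT.
    have := hR d _ (mem_head _ _) hq; rewrite eqxx permM tpermD ?lift_perm_lift //.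
    by rewrite (inj_eq (@lift_inj _ ord0)) eq_sym.
  have := hR e _ _ hq; rewrite inE el orbT => /(_ isT).
  by rewrite (negPf ne) mul1g lift_perm_lift.
by move=> q; case: (unliftP ord0 q) => [j ->|->].
Qed.

(* Starting with [d], the walk either moves on to [d + 1] or first goes to
   [d + 1] and back, which toggles the parities of [d] and [d + 1]. *)
Lemma exists_walk (f : nat -> bool) (k d : nat) : exists l,
  [/\ path near d l, all [pred e | (d < e <= d + k)%N] l &
      forall e, (d < e <= d + k)%N -> odd (count_mem e l) = f e].
Proof.
elim: k d f => [|k IHk] d f.
  by exists [::]; split=> // e; lia.
case fd : (f d.+1).
  have [l [h1 h2 h3]] := IHk d.+1 f; exists (d.+1 :: l); split=> /=.
  - by rewrite /near eqxx orbT.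
  - rewrite -addSnnS leqnn leq_addr; apply: sub_all h2 => e /=; lia.
  - move=> e he; rewrite oddD oddb; have [<-|ne] := eqVneq d.+1 e.
      rewrite fd (_ : count_mem _ l = 0)%N //; apply/count_memPn/negP => /(allP h2) /=.
      by rewrite ltnn.
    by rewrite h3 //; lia.
case: k IHk => [|k] IHk.
  by exists [::]; split=> // e he; have -> : e = d.+1 by lia.
(* The detour visits [d.+2] once, so the rest of the walk needs the opposite parity there. *)
have [l [h1 h2 h3]] := IHk d.+1 (fun e => f e (+) (e == d.+2)).
exists [:: d.+1, d.+2, d.+1 & l]; split=> /=.
- by rewrite /near !eqxx ?orbT.
- rewrite !andbA; apply/andP; split; first by lia.
  by apply: sub_all h2 => e /=; lia.
- move=> e he; rewrite !oddD !oddb; have [<-|ne] := eqVneq d.+1 e.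
    rewrite fd (_ : count_mem _ l = 0)%N; last first.
      by apply/count_memPn/negP => /(allP h2) /=; rewrite ltnn.
    by rewrite gtn_eqF.
  rewrite h3; last by lia.
  by rewrite [e == _]eq_sym; case: (f e); case: (d.+2 == e).
Qed.

(** * Choice of [t] and of a side of it *)

Lemma one_sided_type_two n (I : {set 'I_n}) (t : 'I_n) (side : pred 'I_n) (D : nat) :
  t \notin I -> (2 <= D)%N ->
  (forall i : 'I_n, side i -> (0 < `|i - t| <= D)%N) ->
  (forall i j : 'I_n, side i -> side j -> `|i - j|%N = `| `|i - t|%N - `|j - t|%N |%N) ->
  (forall e : nat, (0 < e <= D)%N -> exists2 i : 'I_n, side i & `|i - t|%N = e) ->
  (forall i, i != t -> ~~ side i -> i \in I) ->
  exists M : maniplex n, of_type_two M I.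
Proof.
move=> tI D_ge2 side_range side_dist side_surj side_I.
pose f e := [exists i : 'I_n, [&& side i, `|i - t|%N == e & i \notin I]].
have [l [hl lD lf]] := exists_walk f D 0.
(* The prefix keeps all parities and makes the path long enough even if [l] is empty; a non-empty
   [l] starts with 1, which is adjacent to 2. *)
pose L := [:: 1, 2, 1, 2 & l]%N.
have hL : path near 0 L.
  rewrite /L /=; case: l hl {lD lf L} => //= a l /andP[ha ->].
  by rewrite andbT; move: ha; rewrite /near; lia.
have L_range e : e \in L -> (0 < e <= D)%N.
  have D_gt0 := ltnW D_ge2.
  by rewrite !inE => /or4P[/eqP->|/eqP->|/eqP->|/orP[/eqP->|/(allP lD)]];
    rewrite /= ?D_gt0 ?D_ge2.
have L_count e : odd (count_mem e L) = odd (count_mem e l).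
  rewrite -[L]/([:: 1; 2; 1; 2]%N ++ l) count_cat oddD.
  by case: e => [|[|[|e]]].
(* Labels are distances from [t]. The other indices get the identity, whose evenness agrees with
   their being in [I]. *)
pose s (i : 'I_n) : 'S_(size L).+1 := if side i then path_perm L `|i - t|%N else 1%g.
apply: (@permutation_type_two n I t _ s ord0) => //.
- move=> i _; rewrite /s; case: ifP => _; last by rewrite mulg1.
  exact: path_permK hL.
- move=> i j _ _ ij; rewrite /s; case: ifP => hi; case: ifP => hj; rewrite ?mul1g ?mulg1 //.
  by apply: (path_permC hL); rewrite -side_dist.
- move=> i it; rewrite /s; case: ifP => _; last by rewrite perm1.
  by apply: (path_perm_fix0 hL); lia.
- move=> i it; rewrite /s; case: ifPn => hi; last by rewrite odd_perm1 side_I.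
  rewrite odd_path_perm L_count lf ?side_range //.
  apply/existsP/idP => [[j /and3P[hj /eqP jd jI]]|iI]; last by exists i; rewrite hi eqxx.
  suff -> : i = j by [].
  by apply/val_inj; have := side_dist _ _ hi hj; rewrite jd distnn => /=; lia.
- move=> R R0 hR; apply: (path_perm_orbit hL R0) => e q /L_range he hq.
  have [i hi ie] := side_surj e he.
  have := hR i q _ hq; rewrite /s hi ie; apply.
  by apply: contraTneq he => it; rewrite -ie it distnn.
Qed.

(** With [t] = 1, the indices 0 and 2 need commuting even involutions transitive on the points: the
    generators [u] and [v] of the regular Klein four-group. *)
Lemma middle_type_two (I : {set 'I_3}) : (forall i : 'I_3, (i \in I) = (i != 1%N :> nat)) ->
  exists M : maniplex 3, of_type_two M I.
Proof.
move=> hI.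
pose o k (hk : (k < 4)%N) : 'I_4 := Ordinal hk.
pose a0 := o 0%N isT; pose a1 := o 1%N isT; pose a2 := o 2%N isT; pose a3 := o 3%N isT.
pose u : 'S_4 := (tperm a0 a1 * tperm a2 a3)%g.
pose v : 'S_4 := (tperm a0 a2 * tperm a1 a3)%g.
have all4 (P : 'I_4 -> Prop) : P a0 -> P a1 -> P a2 -> P a3 -> forall q, P q.
  move=> P0 P1 P2 P3 [[|[|[|[|k]]]] hk] //.
  - by rewrite (_ : Ordinal hk = a0) //; apply: val_inj.
  - by rewrite (_ : Ordinal hk = a1) //; apply: val_inj.
  - by rewrite (_ : Ordinal hk = a2) //; apply: val_inj.
  - by rewrite (_ : Ordinal hk = a3) //; apply: val_inj.
have uE : [/\ u a0 = a1, u a1 = a0, u a2 = a3 & u a3 = a2].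
  by split; rewrite /u permM !permE.
have vE : [/\ v a0 = a2, v a1 = a3, v a2 = a0 & v a3 = a1].
  by split; rewrite /v permM !permE.
have u_odd : u = false :> bool by rewrite odd_permM !odd_tperm.
have v_odd : v = false :> bool by rewrite odd_permM !odd_tperm.
clearbody u v; case: uE vE => u0 u1 u2 u3 [v0 v1 v2 v3].
pose s (i : 'I_3) := if i == 0%N :> nat then u else v.
have t1 : (1 < 3)%N by [].
apply: (@permutation_type_two 3 I (Ordinal t1) _ s a0) => //.
- by rewrite hI.
- move=> i _; rewrite /s; case: ifP => _; apply/permP; apply: all4;
    by rewrite permM perm1; rewrite !(u0, u1, u2, u3, v0, v1, v2, v3).
- move=> i j _ _ _; rewrite /s; case: ifP => _; case: ifP => _ //; apply/permP; apply: all4;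
    by rewrite !permM; rewrite !(u0, u1, u2, u3, v0, v1, v2, v3).
- by case=> [[|[|[|i]]] hi].
- move=> i it; rewrite hI (_ : (i != 1%N :> nat)) // /s.
  by case: ifP.
- have i0 : (0 < 3)%N by []. have i2 : (2 < 3)%N by [].
  move=> R R0 hR; have hu q : R q -> R (u q) := hR (Ordinal i0) q isT.
  have hv q : R q -> R (v q) := hR (Ordinal i2) q isT.
  have R1 : R a1 by rewrite -u0; exact: hu.
  by apply: all4 => //; [rewrite -v0 | rewrite -v1]; exact: hv.
Qed.

Theorem theorem3 (n : nat) (I : {set 'I_n}) :
  (3 <= n)%N -> I \proper [set: 'I_n] ->
  exists M : maniplex n, of_type_two M I.
Proof.
move=> n_ge3 /properP[_ [x _ xI]].
have [t tI t_max] : exists2 t : 'I_n, t \notin I & forall i : 'I_n, (t < i)%N -> i \in I.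
  case: (@arg_maxnP _ x [pred i | i \notin I] val xI) => t /= tI ht; exists t => // i.
  by rewrite ltnNge; apply: contraNT => /ht.
(* If [t] is at least 2, the side below it has two indices, and all indices above are in [I]. *)
have [t_ge2|t_lt2] := leqP 2 t.
  apply: (@one_sided_type_two n I t [pred i : 'I_n | i < t]%N t) => //=.
  - by move=> i; lia.
  - by move=> i j; lia.
  - move=> e he; have hi : (t - e < n)%N by have := ltn_ord t; lia.
    by exists (Ordinal hi) => /=; lia.
  - by move=> i; rewrite -leqNgt leq_eqVlt => it /orP[/eqP/val_inj ti|/t_max //];
      rewrite ti eqxx in it.
(* Otherwise the side above the least index outside [I] is tried. *)
have [t' t'I t'_min] : exists2 t : 'I_n, t \notin I & forall i : 'I_n, (i < t)%N -> i \in I.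
  case: (@arg_minnP _ x [pred i | i \notin I] val xI) => t' /= t'I ht; exists t' => // i.
  by rewrite ltnNge; apply: contraNT => /ht.
have [t'_le|t'_gt] := leqP t'.+3 n.
  apply: (@one_sided_type_two n I t' [pred i : 'I_n | t' < i]%N (n.-1 - t')) => //=.
  - by lia.
  - by move=> i; have := ltn_ord i; lia.
  - by move=> i j; lia.
  - move=> e he; have hi : (t' + e < n)%N by lia.
    by exists (Ordinal hi) => /=; lia.
  - by move=> i; rewrite -leqNgt leq_eqVlt => it /orP[/eqP/val_inj ti|/t'_min //];
      rewrite ti eqxx in it.
(* Now n - 2 <= t' <= t <= 1 forces n = 3 and t' = t = 1, so that [I] consists of 0 and 2. *)
have t'_le_t : (t' <= t)%N by rewrite leqNgt; apply: contra tI => /t'_min.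
have n3 : n = 3%N by lia.
subst n; apply: middle_type_two => i.
have [i1|ne] := eqVneq (val i) 1%N.
  by apply/negbTE; rewrite (_ : i = t) //; apply: val_inj; rewrite /= i1; lia.
have [it|ti] := ltnP i t'; first by rewrite t'_min.
by rewrite t_max //; move: ne => /=; lia.
Qed.
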